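(* Let $a(x),b(x)\in\mathbb{Z}[x]$ with $\deg b=2\deg a=2d$, $d\ge 1$, and let $A,B$ be the leading coefficients of $a,b$. Assume $B>-A^2/4$, and let $p_n,q_n$ be the numerators and denominators of the convergents of $\mathrm{PCF}[a_n,b_n]$, which converge to a limit $L$. Let $\delta$ be the effective irrationality measure of the sequence $p_n/q_n$ (with reduced denominators). If $\delta>-1$ (in particular, if the sequence proves irrationality of $L$, i.e. $\delta>0$), then the PCF has factorial reduction, i.e. $$\limsup_{n\to\infty}\frac1n\ln\!\left(\frac{\gcd(p_n,q_n)}{(n!)^{d}}\right)>-\infty.$$ Equivalently, the reduced numerators $p_n/\gcd(p_n,q_n)$ and denominators $q_n/\gcd(p_n,q_n)$ are (along a subsequence) of exponential rather than factorial order.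
   Context: A polynomial continued fraction (PCF) is $\mathrm{PCF}[a_n,b_n]=a_0+\cfrac{b_1}{a_1+\cfrac{b_2}{a_2+\cdots}}$ with $a_n=a(n)$, $b_n=b(n)$ for integer polynomials $a,b$. Its $n$-th convergent is $p_n/q_n$, where both sequences satisfy $u_n=a_nu_{n-1}+b_nu_{n-2}$ with $p_{-1}=1,p_0=a_0$, $q_{-1}=0,q_0=1$. The PCF is ''balanced-degree'' when $\deg b_n/\deg a_n=2$. The effective irrationality measure $\delta$ of the sequence $p_n/q_n\to L$ is the largest $\delta$ such that $\left|L-\frac{p_n}{q_n}\right|<\left(\frac{q_n}{\gcd(p_n,q_n)}\right)^{-(1+\delta)}$ for almost all $n$; ''nontrivial'' means $\delta>-1$. The PCF is said to have factorial reduction (FR) when $\limsup_n \frac1n\ln(\gcd(p_n,q_n)/n!^{\deg a})>-\infty$. *)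

(* Defs.v *)
From HB Require Import structures.
From mathcomp Require Import all_boot all_order all_algebra.
From mathcomp Require Import all_classical all_reals all_analysis.

Set Implicit Arguments.
Unset Strict Implicit.
Unset Printing Implicit Defensive.

Import Order.TTheory GRing.Theory Num.Theory.
Import numFieldNormedType.Exports.

Local Open Scope classical_set_scope.
Local Open Scope ring_scope.

(* The pair (u_n, u_(n-1)) for u_n = a(n) u_(n-1) + b(n) u_(n-2); keeping both
   terms lets the recurrence start from the values u_0 and u_(-1). *)
Fixpoint pcf_rec (a b : {poly int}) (u0 um1 : int) (n : nat) : int * int :=
  if n is m.+1 then
    let: (u, v) := pcf_rec a b u0 um1 m in
    (a.[n%:Z] * u + b.[n%:Z] * v, u)
  else (u0, um1).

Definition pcf_num (a b : {poly int}) (n : nat) : int :=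
  (pcf_rec a b a.[0] 1 n).1.

Definition pcf_den (a b : {poly int}) (n : nat) : int :=
  (pcf_rec a b 1 0 n).1.

Definition pcf_gcd (a b : {poly int}) (n : nat) : int :=
  gcdz (pcf_num a b n) (pcf_den a b n).

Definition pcf_convergent (R : realType) (a b : {poly int}) (n : nat) : R :=
  (pcf_num a b n)%:~R / (pcf_den a b n)%:~R.

(* Since x / 0 = 0, the convergents must also be required to be defined from
   some index on. *)
Definition pcf_converges_to (R : realType) (a b : {poly int}) (L : R) : Prop :=
  (\forall n \near \oo, pcf_den a b n != 0) /\
  pcf_convergent R a b n @[n --> \oo] --> L.

(* q_n may be negative: the size of the reduced denominator is |q_n| / gcd. *)
Definition pcf_reduced_den (R : realType) (a b : {poly int}) (n : nat) : R :=
  `|(pcf_den a b n)%:~R| / (pcf_gcd a b n)%:~R.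

Definition pcf_reduced_num (R : realType) (a b : {poly int}) (n : nat) : R :=
  `|(pcf_num a b n)%:~R| / (pcf_gcd a b n)%:~R.

(* The largest admissible exponent, taken as a supremum in the extended reals:
   it need not be attained, and it is +oo e.g. when the convergents are
   eventually equal to L. *)
Definition irrationality_measure (R : realType) (a b : {poly int}) (L : R) :
    \bar R :=
  ereal_sup [set delta%:E | delta in [set delta : R |
    \forall n \near \oo,
      `|L - pcf_convergent R a b n|
        < pcf_reduced_den R a b n `^ (- (1 + delta))]].

(* lne is the extended logarithm, with lne 0 = -oo. *)
Definition factorial_reduction (R : realType) (a b : {poly int}) : Prop :=
  (-oo < limn_esup (fun n : nat =>
     (n%:R^-1)%:E *
     lne ((pcf_gcd a b n)%:~R / n`!%:R ^+ (size a).-1 : R)%:E))%E.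

(* Exponential order is an e^(O(n)) bound, for the numerators and the
   denominators along one and the same subsequence. *)
Definition exponential_order_subseq (R : realType) (a b : {poly int}) : Prop :=
  exists (C : R) (phi : nat -> nat),
    increasing_seq phi /\
    forall k, pcf_reduced_num R a b (phi k) <= C ^+ phi k /\
              pcf_reduced_den R a b (phi k) <= C ^+ phi k.

(* Main.v *)
(** After division by [(n!)^d], the numerators and denominators solve a linear
    recurrence [v (n+2) = al n * v (n+1) + be n * v n] with bounded coefficients
    and [|be n| >= 1/2] eventually.  Hence solutions grow at most exponentially,
    and since the recurrence can be reversed, a nonzero solution is
    exponentially bounded below along infinitely many indices.  If the
    Casoratian of the two sequences vanishes at some late index, the reduced
    fractions are eventually constant and the gcd is comparable to [|q_n|].
    Otherwise [r_n = p_n - L q_n] is a nonzero solution: whenever it is large,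
    [q_n] is large as well, since [p_n / q_n] converges to [L], and
    [|L - p_n / q_n|] is at least exponentially small; a measure [> -1] then
    bounds the reduced denominator exponentially.  Finally, the Casoratian
    bounds [|p_n| + |q_n|] from below at every late index, so that reduced
    fractions of exponential order force a large gcd. *)

Require Import Defs.
From HB Require Import structures.
From mathcomp Require Import all_boot all_order all_algebra.
From mathcomp Require Import all_classical all_reals all_analysis.
From mathcomp Require Import ring lra zify.

Set Implicit Arguments.
Unset Strict Implicit.
Unset Printing Implicit Defensive.

Import Order.TTheory GRing.Theory Num.Theory.
Import numFieldNormedType.Exports.

Local Open Scope classical_set_scope.
Local Open Scope ring_scope.

(** * Size of polynomial values at large arguments *)

Lemma horner_le_exp (T : realDomainType) (p : {poly T}) (x : T) (m : nat) :
  1 <= x -> (size p <= m.+1)%N ->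
  `|p.[x]| <= (\sum_(i < size p) `|p`_i|) * x ^+ m.
Proof.
move=> x1 sp; rewrite horner_coef mulr_suml (le_trans (ler_norm_sum _ _ _))//.
apply: ler_sum => i _.
rewrite normrM (@ger0_norm _ (x ^+ i)) ?exprn_ge0 ?(le_trans ler01)//.
by rewrite ler_wpM2l// ler_weXn2l// -ltnS (leq_trans (ltn_ord i)).
Qed.

(** A nonzero integer leading coefficient has absolute value at least 1, and for large [n] the
    lower-degree terms take up at most half of [n ^ k]. *)
Lemma horner_ge_exp (p : {poly int}) (k : nat) :
  size p = k.+1 ->
  exists N : nat, forall n, (N <= n)%N -> n%:Z ^+ k <= 2 * `|p.[n%:Z]|.
Proof.
move=> sp; pose p' := \poly_(i < k) p`_i.
have pE x : p.[x] = p'.[x] + lead_coef p * x ^+ k.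
  by rewrite horner_coef sp big_ord_recr/= horner_poly lead_coefE sp.
have lc : 1 <= `|lead_coef p|.
  have : lead_coef p != 0 by rewrite lead_coef_eq0 -size_poly_eq0 sp.
  by move: (lead_coef p) => z; lia.
have [k0|k0] := posnP k.
  exists 0%N => n _; move: pE; rewrite /p' k0 => pE.
  rewrite pE horner_poly big_ord0 add0r expr0; lia.
pose S : int := \sum_(i < size p') `|p'`_i|.
have S0 : 0 <= S by apply: sumr_ge0.
exists (absz (2 * S)).+1 => n hn.
have n1 : 1 <= n%:Z by lia.
have sp' : (size p' <= k.-1.+1)%N by rewrite prednK// size_poly.
have := horner_le_exp n1 sp'; rewrite -/S => up.
have nS : 2 * S <= n%:Z by lia.
have kE : n%:Z ^+ k = n%:Z * n%:Z ^+ k.-1 by rewrite -exprS prednK.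
have y0 : 0 <= n%:Z ^+ k.-1 by rewrite exprn_ge0.
have h1 : 2 * `|p'.[n%:Z]| <= n%:Z ^+ k.
  rewrite kE (@le_trans _ _ (2 * S * n%:Z ^+ k.-1))//.
    by rewrite -mulrA ler_wpM2l.
  by rewrite ler_wpM2r.
have h2 : n%:Z ^+ k <= `|lead_coef p * n%:Z ^+ k|.
  rewrite normrM [X in _ * X]ger0_norm ?exprn_ge0//.
  by rewrite ler_peMl// exprn_ge0.
have aux (x y z : int) : 2 * `|x| <= z -> z <= `|y| -> z <= 2 * `|x + y|.
  by lia.
by rewrite pE; apply: aux.
Qed.

(** * Growth of solutions of second-order linear recurrences *)

Section LinearRecurrence.
Variables (R : realFieldType) (al be : nat -> R) (K c : R) (N : nat).
Hypothesis alK : forall n, `|al n| <= K.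
Hypothesis beK : forall n, `|be n| <= K.
Hypothesis c0 : 0 < c.
Hypothesis bec : forall n, (N <= n)%N -> c <= `|be n|.

Definition lin_rec (v : nat -> R) :=
  forall n, v n.+2 = al n * v n.+1 + be n * v n.

Lemma lin_rec_upper (v : nat -> R) : lin_rec v ->
  exists2 C : R, 1 <= C & forall n, `|v n| <= C ^+ n.+1.
Proof.
move=> vE.
have K0 : 0 <= K by apply: le_trans (alK 0%N).
(* Each of the two terms of the recurrence contributes at most [K * C ^ n.+2], whence [2 * K]. *)
pose C := `|v 0%N| + `|v 1%N| + 2 * K + 1.
have v0 : 0 <= `|v 0%N| by []. have v1 : 0 <= `|v 1%N| by [].
have C1 : 1 <= C by rewrite /C; lra.
exists C => // n; suff: `|v n| <= C ^+ n.+1 /\ `|v n.+1| <= C ^+ n.+2 by case.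
elim: n => [|n [h1 h2]].
  split; first by rewrite expr1 /C; lra.
  by rewrite (@le_trans _ _ C)// ?ler_eXnr// /C; lra.
split=> //; rewrite vE.
have Cn : 0 <= C ^+ n.+2 by rewrite exprn_ge0// (le_trans ler01).
have h3 : `|v n| <= C ^+ n.+2.
  by rewrite (le_trans h1)// ler_weXn2l.
rewrite (le_trans (ler_normD _ _))// !normrM.
have e1 : `|al n| * `|v n.+1| <= K * C ^+ n.+2 by rewrite ler_pM.
have e2 : `|be n| * `|v n| <= K * C ^+ n.+2 by rewrite ler_pM.
rewrite (le_trans (lerD e1 e2))// -mulrDl [leRHS]exprS ler_wpM2r// /C; lra.
Qed.

Lemma geometric_lower (E : nat -> R) (e : R) :
  0 < e -> 0 < E N -> (forall n, (N <= n)%N -> e * E n <= E n.+1) ->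
  exists2 f : R, 0 < f & forall n, (N <= n)%N -> f ^+ n.+1 <= E n.
Proof.
move=> e0 EN0 EE; pose f := Num.min 1 (Num.min e (E N)).
have f0 : 0 < f by rewrite /f !lt_min ltr01 e0.
exists f => // n Nn; rewrite -(subnK Nn); elim: (n - N)%N => [|k IH].
  rewrite add0n exprS (@le_trans _ _ f)//.
    by rewrite ler_piMr ?(ltW f0)// exprn_ile1 ?(ltW f0)// ge_min lexx.
  by rewrite /f !ge_min lexx !orbT.
rewrite addSn exprS (le_trans _ (EE _ (leq_addl _ _)))//.
rewrite ler_pM ?(ltW f0) ?exprn_ge0 ?(ltW f0)//.
by rewrite /f !ge_min lexx orbT.
Qed.

(* Beyond [N] the recurrence can be run backwards with bounded coefficients. *)
Lemma lin_rec_lower_pair (v : nat -> R) : lin_rec v ->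
  0 < `|v N| + `|v N.+1| ->
  exists2 f : R, 0 < f &
    forall n, (N <= n)%N -> f ^+ n.+1 <= `|v n| + `|v n.+1|.
Proof.
move=> vE vN.
have K0 : 0 <= K by apply: le_trans (alK 0%N).
(* Solving the recurrence for [v n] costs a factor [(K + 1) / c]; the added 1 accounts for the term
   [v n.+1] of the pair. *)
pose M := (K + 1) / c + 1.
have Kc : 0 <= (K + 1) / c by rewrite divr_ge0 ?(ltW c0)//; lra.
have M0 : 0 < M by rewrite /M; lra.
apply: (@geometric_lower (fun n => `|v n| + `|v n.+1|) M^-1) => //.
  by rewrite invr_gt0.
move=> n Nn; rewrite mulrC ler_pdivrMr//.
have key : c * `|v n| <= `|v n.+2| + K * `|v n.+1|.
  have -> : `|v n.+2| = `|al n * v n.+1 + be n * v n| by rewrite vE.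
  have h1 : c * `|v n| <= `|be n * v n| by rewrite normrM ler_wpM2r// bec.
  have h2 : `|al n * v n.+1| <= K * `|v n.+1| by rewrite normrM ler_wpM2r.
  have := ler_normB (al n * v n.+1 + be n * v n) (al n * v n.+1).
  rewrite [X in `|X|](_ : _ = be n * v n); last by ring.
  lra.
have x0 : 0 <= `|v n.+1| by []. have y0 : 0 <= `|v n.+2| by [].
have hv : `|v n| <= (K + 1) / c * (`|v n.+1| + `|v n.+2|).
  rewrite mulrAC ler_pdivlMr// mulrC (le_trans key)//.
  have := mulr_ge0 K0 y0; nra.
by rewrite /M; lra.
Qed.

(** One of two consecutive terms carries at least half of the lower bound on their sum; the factor
    1/2 is absorbed into the base of the power. *)
Lemma lin_rec_lower_often (v : nat -> R) : lin_rec v ->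
  0 < `|v N| + `|v N.+1| ->
  exists2 f : R, 0 < f &
    forall m, exists2 n, (m <= n)%N & f ^+ n.+1 <= `|v n|.
Proof.
move=> vE /(lin_rec_lower_pair vE)[f f0 fv].
pose g := Num.min 1 (f / 2).
have g0 : 0 < g by rewrite /g lt_min ltr01 divr_gt0.
have g1 : g <= 1 by rewrite /g ge_min lexx.
have gf n : 2 * g ^+ n.+1 <= f ^+ n.+1.
  rewrite (@le_trans _ _ (2 * (f / 2) ^+ n.+1))//.
    by rewrite ler_wpM2l// lerXn2r ?nnegrE ?(ltW g0) ?divr_ge0 ?(ltW f0)//
      /g ge_min lexx orbT.
  rewrite expr_div_n mulrCA ler_piMr ?exprn_ge0 ?(ltW f0)//.
  by rewrite ler_pdivrMr ?exprn_gt0// mul1r ler_eXnr// ler1n.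
exists g => // m; have := fv _ (leq_maxr m N); set n := maxn m N => h.
have := gf n; have [hn _|hn hf] := leP (g ^+ n.+1) `|v n|.
  by exists n => //; rewrite leq_maxl.
exists n.+1; first by rewrite leqW// leq_maxl.
have : g ^+ n.+2 <= g ^+ n.+1 by rewrite ler_wiXn2l// ltW.
move: h hn hf; lra.
Qed.

(** The discrete Wronskian: where [v] is nonzero, it vanishes at [n] exactly when [u / v] takes the
    same value at [n] and [n.+1]. *)
Definition casoratian (u v : nat -> R) n := u n.+1 * v n - u n * v n.+1.

Lemma casoratianS (u v : nat -> R) n : lin_rec u -> lin_rec v ->
  casoratian u v n.+1 = - be n * casoratian u v n.
Proof. by move=> uE vE; rewrite /casoratian uE vE; ring. Qed.

Lemma casoratian0 (u v : nat -> R) : lin_rec u -> lin_rec v ->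
  casoratian u v N = 0 -> forall n, (N <= n)%N -> casoratian u v n = 0.
Proof.
move=> uE vE h n Nn; rewrite -(subnK Nn).
by elim: (n - N)%N => // k IH; rewrite addSn casoratianS// IH mulr0.
Qed.

(* If both solutions were small at [n], so would be their Casoratian. *)
Lemma lin_rec_lower_max (u v : nat -> R) : lin_rec u -> lin_rec v ->
  casoratian u v N != 0 ->
  exists2 f : R, 0 < f & forall n, (N <= n)%N -> f ^+ n.+1 <= `|u n| + `|v n|.
Proof.
move=> uE vE; rewrite -normr_gt0 => W0.
have [f f0 fW] : exists2 f : R, 0 < f &
    forall n, (N <= n)%N -> f ^+ n.+1 <= `|casoratian u v n|.
  apply: (geometric_lower c0 W0) => n Nn.
  by rewrite casoratianS// normrM normrN ler_wpM2r// bec.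
have [C C1 uC] := lin_rec_upper uE; have [D D1 vD] := lin_rec_upper vE.
pose H := C * D; have H1 : 1 <= H by rewrite /H mulr_ege1.
have CH : C <= H by rewrite /H ler_peMr// (le_trans ler01).
have DH : D <= H by rewrite /H ler_peMl// (le_trans ler01).
have H0 : 0 < H by rewrite (lt_le_trans ltr01).
(* The bounds at [n.+1] cost [H ^ n.+2], and [n.+2 <= 2 * n.+1]. *)
exists (f / H ^+ 2) => [|n Nn]; first by rewrite divr_gt0// exprn_gt0.
rewrite expr_div_n ler_pdivrMr ?exprn_gt0// (le_trans (fW n Nn))//.
have uH : `|u n.+1| <= H ^+ n.+2.
  by rewrite (le_trans (uC _))// lerXn2r ?nnegrE ?(le_trans ler01).
have vH : `|v n.+1| <= H ^+ n.+2.
  by rewrite (le_trans (vD _))// lerXn2r ?nnegrE ?(le_trans ler01).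
rewrite (@le_trans _ _ ((`|u n| + `|v n|) * H ^+ n.+2))//; last first.
  by rewrite ler_wpM2l ?addr_ge0// -exprM ler_weXn2l//; lia.
rewrite /casoratian (le_trans (ler_normB _ _))// !normrM.
have e1 := ler_wpM2r (normr_ge0 (v n)) uH.
have e2 := ler_wpM2l (normr_ge0 (u n)) vH.
lra.
Qed.

End LinearRecurrence.

(** * Rescaling of the continued fraction recurrence by [(n!)^d] *)

Lemma pcf_recS (a b : {poly int}) (u0 um1 : int) n :
  (pcf_rec a b u0 um1 n.+2).1 = a.[n.+2%:Z] * (pcf_rec a b u0 um1 n.+1).1 +
                                b.[n.+2%:Z] * (pcf_rec a b u0 um1 n).1.
Proof. by rewrite /=; case: (pcf_rec a b u0 um1 n) => x y. Qed.

Section Scaling.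
Variables (R : realType) (d : nat) (a b : {poly int}).

Definition scaled (u : nat -> int) (n : nat) : R := (u n)%:~R / n`!%:R ^+ d.

Definition scaled_a (n : nat) : R := a.[n.+2%:Z]%:~R / n.+2%:R ^+ d.

(** Two factors appear since [(n+2)! = (n+2) (n+1) n!]; together they balance a [b] of degree
    [2d]. *)
Definition scaled_b (n : nat) : R :=
  b.[n.+2%:Z]%:~R / (n.+2%:R ^+ d * n.+1%:R ^+ d).

Lemma fact_exp_gt0 n : 0 < n`!%:R ^+ d :> R.
Proof. by rewrite exprn_gt0// ltr0n fact_gt0. Qed.

Lemma scaled_lin_rec (u : nat -> int) :
  (forall n, u n.+2 = a.[n.+2%:Z] * u n.+1 + b.[n.+2%:Z] * u n) ->
  lin_rec scaled_a scaled_b (scaled u).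
Proof.
move=> uE n; rewrite /scaled /scaled_a /scaled_b uE intrD !intrM !factS !natrM.
rewrite !exprMn.
have f0 : n`!%:R ^+ d != 0 :> R by rewrite gt_eqF// fact_exp_gt0.
have n0 m : m.+1%:R ^+ d != 0 :> R by rewrite gt_eqF// exprn_gt0.
by field; rewrite f0 !n0.
Qed.

Hypotheses (ha : size a = d.+1) (hb : size b = (2 * d).+1).

Lemma scaled_bounded :
  exists K : R, forall n, `|scaled_a n| <= K /\ `|scaled_b n| <= K.
Proof.
pose Sa : int := \sum_(i < size a) `|a`_i|.
pose Sb : int := \sum_(i < size b) `|b`_i|.
have Sa0 : 0 <= Sa%:~R :> R by rewrite ler0z sumr_ge0.
have Sb0 : 0 <= Sb%:~R * 2 ^+ d :> R.
  by rewrite mulr_ge0// ?ler0z ?sumr_ge0// exprn_ge0.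
exists (Sa%:~R + Sb%:~R * 2 ^+ d) => n.
have nd m : 0 < m.+1%:R ^+ d :> R by rewrite exprn_gt0.
have n1 : 1 <= n.+2%:Z by [].
split.
  rewrite normrM normfV (@gtr0_norm _ (_ ^+ d))// ler_pdivrMr//.
  rewrite (@le_trans _ _ (Sa%:~R * n.+2%:R ^+ d))//; last first.
    by rewrite ler_wpM2r ?(ltW (nd _))// lerDl.
  have sa : (size a <= d.+1)%N by rewrite ha.
  have := horner_le_exp n1 sa; rewrite -/Sa.
  by rewrite -(ler_int R) intr_norm intrM rmorphXn.
rewrite normrM normfV (@gtr0_norm _ (_ * _)) ?mulr_gt0//.
rewrite ler_pdivrMr ?mulr_gt0//.
have sb : (size b <= (2 * d).+1)%N by rewrite hb.
have := horner_le_exp n1 sb; rewrite -/Sb.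
rewrite -(ler_int R) intr_norm intrM rmorphXn => /le_trans; apply.
(* The factor [2 ^ d] comes from [n + 2 <= 2 (n + 1)]. *)
rewrite (@le_trans _ _ (Sb%:~R * 2 ^+ d * (n.+2%:R ^+ d * n.+1%:R ^+ d)))//.
  rewrite -mulrA ler_wpM2l ?ler0z ?sumr_ge0//.
  rewrite mul2n -addnn exprD mulrCA ler_wpM2l ?(ltW (nd _))//.
  rewrite -exprMn lerXn2r ?nnegrE ?mulr_ge0//.
  by rewrite -natrM ler_nat; lia.
by rewrite ler_wpM2r ?mulr_ge0 ?(ltW (nd _))// lerDr.
Qed.

Lemma scaled_b_lower :
  exists N : nat, forall n, (N <= n)%N -> 2^-1 <= `|scaled_b n|.
Proof.
have [N hN] := horner_ge_exp hb; exists N => n Nn.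
have nd m : 0 < m.+1%:R ^+ d :> R by rewrite exprn_gt0.
have := hN n.+2 (leqW (leqW Nn)).
rewrite -(ler_int R) intrM intr_norm rmorphXn/= => h.
rewrite normrM normfV (@gtr0_norm _ (_ * _)) ?mulr_gt0//.
rewrite ler_pdivlMr ?mulr_gt0//.
rewrite mulrC ler_pdivrMr// [leRHS]mulrC (le_trans _ h)//.
rewrite mul2n -addnn exprD ler_wpM2l ?(ltW (nd _))//.
by rewrite lerXn2r ?nnegrE ?ler_nat.
Qed.

End Scaling.

(** * Factorial reduction as an exponential lower bound on the scaled gcd *)

Lemma limn_esup_gtNy (R : realType) (u : nat -> \bar R) :
  (-oo < limn_esup u)%E <->
  exists K : R, forall m, exists2 n, (m <= n)%N & (K%:E <= u n)%E.
Proof.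
rewrite /limn_esup /limf_esup; set I := ereal_inf _; split => [I0|[K uK]].
  have [K KI] : exists K : R, (K%:E < I)%E.
    case: I I0 => // [r _|_]; last by exists 0; rewrite ltry.
    by exists (r - 1); rewrite lte_fin; lra.
  exists K => m.
  have /ereal_sup_gt[_ [n /= mn <-] /ltW Kn] :
      (K%:E < ereal_sup [set u n | n in [set n | (m <= n)%N]])%E.
    apply: (lt_le_trans KI); apply: ereal_inf_lbound.
    by exists [set n | (m <= n)%N] => //; exact: nbhs_infty_ge.
  by exists n.
apply: (@lt_le_trans _ _ K%:E); first exact: ltNyr.
apply: le_ereal_inf_tmp => _ [V [m _ mV] <-].
have [n mn Kn] := uK m; apply: (le_trans Kn); apply: ereal_sup_ubound.
by exists n => //; apply: mV.
Qed.

Lemma factorial_reductionP (R : realType) (d : nat) (a b : {poly int}) :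
  size a = d.+1 ->
  factorial_reduction R a b <->
  exists2 c : R, 0 < c &
    forall m, exists2 n, (m <= n)%N & c ^+ n.+1 <= scaled R d (pcf_gcd a b) n.
Proof.
move=> ha; rewrite /factorial_reduction limn_esup_gtNy ha/=.
split => [[K hK]|[c c0 hc]].
  pose c := Num.min 1 (expR K).
  have c0 : 0 < c by rewrite /c lt_min ltr01 expR_gt0.
  (* Asking for an index beyond [m.+1] keeps [n] positive; at 0 the factor [1/n] is 0. *)
  exists c => // m; have [n mn Kn] := hK m.+1; exists n; first exact: ltnW.
  have n0 : 0 < n%:R :> R by rewrite ltr0n (leq_trans _ mn).
  move: Kn; rewrite -/(scaled R d (pcf_gcd a b) n).
  (* A nonpositive argument would give [lne] the value [-oo], below [K]. *)
  case: ifPn => [_|]; first by rewrite gt0_muleNy ?lte_fin ?invr_gt0// leeNy_eq.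
  rewrite -ltNge => G0.
  rewrite -EFinM lee_fin ler_pdivlMl// -[_ * _ <= _]ler_expR lnK ?posrE//.
  rewrite expRM_natl; apply: le_trans.
  rewrite exprS (@le_trans _ _ (c ^+ n))//.
    by rewrite ler_piMl ?exprn_ge0 ?(ltW c0)// /c ge_min lexx.
  by rewrite lerXn2r ?nnegrE ?(ltW c0) ?expR_ge0// /c ge_min lexx orbT.
pose e := Num.min 1 c.
have e0 : 0 < e by rewrite /e lt_min ltr01.
(* The square trades the exponent [n.+1] for [n]: [n.+1 <= 2 * n] when [n > 0], and [e <= 1]. *)
exists (ln (e ^+ 2)) => m; have [n mn hn] := hc m.+1.
exists n; first exact: ltnW.
rewrite -/(scaled R d (pcf_gcd a b) n).
have n0 : 0 < n%:R :> R by rewrite ltr0n (leq_trans _ mn).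
have G0 : 0 < scaled R d (pcf_gcd a b) n.
  by rewrite (lt_le_trans _ hn)// exprn_gt0.
case: ifPn => [|_]; first by rewrite leNgt G0.
rewrite -EFinM lee_fin ler_pdivlMl//.
rewrite -ler_expR lnK ?posrE// expRM_natl lnK ?posrE ?exprn_gt0//.
apply: le_trans hn; rewrite (@le_trans _ _ (e ^+ n.+1))//.
  by rewrite -exprM ler_wiXn2l ?(ltW e0)//; [rewrite /e ge_min lexx|lia].
by rewrite lerXn2r ?nnegrE ?(ltW e0) ?(ltW c0)// /e ge_min lexx orbT.
Qed.

Lemma increasing_subseq (P : nat -> Prop) :
  (forall m, exists2 n, (m <= n)%N & P n) ->
  exists2 phi : nat -> nat, increasing_seq phi & forall k, P (phi k).
Proof.
move=> hP.
have {}hP m : exists n, (m <= n)%N /\ P n by have [n] := hP m; exists n.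
have [f hf] := choice hP.
pose phi k := iter k.+1 (f \o S) 0%N.
have phiS k : phi k.+1 = f (phi k).+1 by [].
exists phi; last by move=> k; exact: (hf _).2.
by apply/increasing_seqP => k; rewrite phiS; exact: (hf _).1.
Qed.


(** Take logarithms and divide by [e]. This converts a lower bound on the approximation error into
    an upper bound on the reduced denominator; [0 < e] is where a measure above -1 enters. *)
Lemma powRN_ge_exp (R : realType) (k x e : R) (n : nat) :
  0 < e -> 0 < k -> 0 < x -> k ^+ n <= x `^ (- e) ->
  x <= expR (- (ln k / e)) ^+ n.
Proof.
move=> e0 k0 x0; rewrite /powR gt_eqF// -ler_ln ?posrE ?exprn_gt0 ?expR_gt0//.
rewrite lnXn// expRK -mulr_natl => h.
rewrite -[x in leLHS]lnK ?posrE// -expRM_natl ler_expR.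
rewrite mulrN mulrA -mulNr ler_pdivlMr//; lra.
Qed.

(** * Reduced fractions in terms of the scaled sequences *)

Section Reduced.
Variables (R : realType) (d : nat) (a b : {poly int}).
Let P := scaled R d (pcf_num a b).
Let Q := scaled R d (pcf_den a b).
Let G := scaled R d (pcf_gcd a b).

Lemma scaled_div (u v : nat -> int) n :
  scaled R d u n / scaled R d v n = (u n)%:~R / (v n)%:~R.
Proof.
by rewrite /scaled invfM invrK mulrACA mulVf ?mulr1// gt_eqF// fact_exp_gt0.
Qed.

Lemma norm_scaled_div (u v : nat -> int) n :
  `|scaled R d u n| / scaled R d v n = `|(u n)%:~R| / (v n)%:~R.
Proof.
have -> : `|scaled R d u n| = scaled R d (fun n => `|u n|) n.
  by rewrite /scaled normrM normfV intr_norm (@gtr0_norm _ (_ ^+ d))//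
    fact_exp_gt0.
by rewrite scaled_div intr_norm.
Qed.

Lemma pcf_reduced_denE n : pcf_reduced_den R a b n = `|Q n| / G n.
Proof. by rewrite norm_scaled_div. Qed.

Lemma pcf_reduced_numE n : pcf_reduced_num R a b n = `|P n| / G n.
Proof. by rewrite norm_scaled_div. Qed.

Lemma pcf_convergentE n : pcf_convergent R a b n = P n / Q n.
Proof. by rewrite scaled_div. Qed.

Lemma scaled_gcd_gt0 n : pcf_den a b n != 0 -> 0 < G n.
Proof.
move=> q0; rewrite divr_gt0 ?fact_exp_gt0// ltr0z lt0r.
by rewrite /pcf_gcd gcdz_eq0 negb_and q0 orbT.
Qed.

Lemma scaled_den_neq0 n : pcf_den a b n != 0 -> Q n != 0.
Proof.
by move=> q0; rewrite mulf_neq0 ?intr_eq0// invr_neq0// gt_eqF// fact_exp_gt0.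
Qed.

(** Vanishing Casoratians make all late convergents equal, and a rational number has a single
    reduced form up to sign. *)
Lemma pcf_reduced_const N :
  (forall n, (N <= n)%N -> pcf_den a b n != 0) ->
  (forall n, (N <= n)%N -> casoratian P Q n = 0) ->
  forall n, (N <= n)%N ->
    pcf_reduced_den R a b n = pcf_reduced_den R a b N /\
    pcf_reduced_num R a b n = pcf_reduced_num R a b N.
Proof.
move=> q0 W0 n Nn.
have PQ : P n / Q n = P N / Q N.
  rewrite -(subnK Nn); elim: (n - N)%N => // k <-; rewrite addSn.
  apply/eqP; rewrite eqr_div ?scaled_den_neq0 ?q0 ?leqW ?leq_addl//.
  by rewrite -subr_eq0; apply/eqP; apply: W0; rewrite leq_addl.
have qn0 := q0 n Nn; have qN0 := q0 N (leqnn N).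
have pq : pcf_num a b n * pcf_den a b N = pcf_num a b N * pcf_den a b n.
  apply: (@intr_inj R); move: PQ; rewrite !scaled_div => /eqP.
  by rewrite eqr_div ?intr_eq0// -!intrM => /eqP.
(* By [pq], both sides are the gcd of [p_n q_N] and [q_n q_N]. *)
have gq : pcf_gcd a b n * `|pcf_den a b N| = pcf_gcd a b N * `|pcf_den a b n|.
  rewrite /pcf_gcd -!abszE !mulz_gcdl pq.
  by rewrite [pcf_den a b n * _]mulrC.
have g0 m : pcf_den a b m != 0 -> (pcf_gcd a b m)%:~R != 0 :> R.
  by move=> qm; rewrite intr_eq0 gcdz_eq0 negb_and qm orbT.
have den : pcf_reduced_den R a b n = pcf_reduced_den R a b N.
  apply/eqP; rewrite /pcf_reduced_den eqr_div ?g0// -!intr_norm -!intrM.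
  by rewrite eqr_int mulrC -gq mulrC.
split=> //.
have numE m : pcf_den a b m != 0 ->
    pcf_reduced_num R a b m = `|P m / Q m| * pcf_reduced_den R a b m.
  move=> qm; rewrite pcf_reduced_numE pcf_reduced_denE (normrM (P m)) normfV.
  by rewrite mulrA divfK// normr_eq0 scaled_den_neq0.
by rewrite !numE// den PQ.
Qed.

End Reduced.

Lemma expr_maxr1_ge (R : realDomainType) (x : R) n : x <= Num.max 1 x ^+ n.+1.
Proof.
have m1 : 1 <= Num.max 1 x by rewrite le_max lexx.
by rewrite (@le_trans _ _ (Num.max 1 x)) ?ler_eXnr// le_max lexx orbT.
Qed.

(** * Large gcd, irrationality measure and exponential order *)

Section Main.
Variables (R : realType) (d : nat) (a b : {poly int}) (L : R).
Hypothesis hL : pcf_converges_to a b L.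

Let P := scaled R d (pcf_num a b).
Let Q := scaled R d (pcf_den a b).
Let G := scaled R d (pcf_gcd a b).

(** Factorial reduction in the form given by [factorial_reductionP]. *)
Definition large_gcd :=
  exists2 c : R, 0 < c & forall m, exists2 n, (m <= n)%N & c ^+ n.+1 <= G n.

Variables (K : R) (N : nat).
Hypotheses (alK : forall n, `|scaled_a R d a n| <= K)
  (beK : forall n, `|scaled_b R d b n| <= K)
  (bec : forall n, (N <= n)%N -> 2^-1 <= `|scaled_b R d b n|)
  (q0 : forall n, (N <= n)%N -> pcf_den a b n != 0).

Let c0 : 0 < 2^-1 :> R. Proof. by rewrite invr_gt0. Qed.

Lemma scaled_num_rec : lin_rec (scaled_a R d a) (scaled_b R d b) P.
Proof. by apply: scaled_lin_rec => n; exact: pcf_recS. Qed.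

Lemma scaled_den_rec : lin_rec (scaled_a R d a) (scaled_b R d b) Q.
Proof. by apply: scaled_lin_rec => n; exact: pcf_recS. Qed.

Let G0 n : (N <= n)%N -> 0 < G n.
Proof. by move=> Nn; apply: scaled_gcd_gt0; exact: q0. Qed.

Let Q0 n : (N <= n)%N -> Q n != 0.
Proof. by move=> Nn; apply: scaled_den_neq0; exact: q0. Qed.

(** Here [G n] is [|Q n|] divided by a constant, and [Q], a nonzero solution, is exponentially large
    infinitely often. *)
Lemma large_gcd_degenerate : casoratian P Q N = 0 -> large_gcd.
Proof.
move=> /(casoratian0 scaled_num_rec scaled_den_rec) W0.
have cst := pcf_reduced_const q0 W0.
have QN : 0 < `|Q N| + `|Q N.+1| by rewrite ltr_wpDr// normr_gt0 Q0.
have [f f0 hf] := lin_rec_lower_often alK c0 bec scaled_den_rec QN.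
pose D := pcf_reduced_den R a b N.
have D1 : 0 < Num.max 1 D by rewrite lt_max ltr01.
exists (f / Num.max 1 D) => [|m]; first by rewrite divr_gt0.
have [n] := hf (maxn m N); rewrite geq_max => /andP[mn Nn] fn.
exists n => //; rewrite expr_div_n ler_pdivrMr ?exprn_gt0// (le_trans fn)//.
have [+ _] := cst n Nn; rewrite (pcf_reduced_denE R d) -/D => QE.
have -> : `|scaled R d (pcf_den a b) n| = G n * D.
  by rewrite -QE mulrC divfK// gt_eqF// G0.
by rewrite ler_wpM2l ?(ltW (G0 _))// expr_maxr1_ge.
Qed.

Lemma exponential_order_degenerate :
  casoratian P Q N = 0 -> exponential_order_subseq R a b.
Proof.
move=> /(casoratian0 scaled_num_rec scaled_den_rec) W0.
have cst := pcf_reduced_const q0 W0.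
pose D := pcf_reduced_den R a b N; pose E := pcf_reduced_num R a b N.
(* The successor keeps the exponent positive, so that powers of the base dominate [D] and [E]. *)
exists (Num.max 1 (Num.max D E)), (fun k => (k + N).+1); split.
  by apply/increasing_seqP => k; rewrite ltEnat/= addSn.
move=> k; have [-> ->] := cst (k + N).+1 (leqW (leq_addl _ _)).
by split; rewrite (le_trans _ (expr_maxr1_ge _ _))// le_max lexx ?orbT.
Qed.

(* [r = P - L Q] also solves the recurrence, so it is exponentially large
   infinitely often; at such indices convergence forces [|Q| > |r|]. *)
Lemma large_gcd_of_irrationality : casoratian P Q N != 0 ->
  ((-1)%:E < irrationality_measure a b L)%E -> large_gcd.
Proof.
move=> W0 /ereal_sup_gt[_ [dl /= hdl <-]]; rewrite lte_fin => dl1.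
have e0 : 0 < 1 + dl by lra.
pose r n := P n - L * Q n.
have rE : lin_rec (scaled_a R d a) (scaled_b R d b) r.
  by move=> n; rewrite /r scaled_num_rec scaled_den_rec; ring.
have rN : 0 < `|r N| + `|r N.+1|.
  rewrite lt0r addr_ge0// andbT paddr_eq0// !normr_eq0.
  apply: contra W0; rewrite /r => /andP[/eqP h1 /eqP h2].
  (* Replacing [P] by [P - L Q] leaves the Casoratian unchanged, so [r] cannot vanish at both [N]
     and [N.+1]. *)
  have -> : casoratian P Q N =
    (P N.+1 - L * Q N.+1) * Q N - (P N - L * Q N) * Q N.+1.
    by rewrite /casoratian; ring.
  by rewrite h1 h2 !mul0r subrr.
have [f f0 hf] := lin_rec_lower_often alK c0 bec rE rN.
have [C C1 QC] := lin_rec_upper alK beK scaled_den_rec.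
have C0 : 0 < C by rewrite (lt_le_trans ltr01).
have [_ /cvgrPdist_lt/(_ 1 ltr01) hcv] := hL.
have [M _ hM] : \forall n \near \oo, [/\ `|L - pcf_convergent R a b n| < 1,
    `|L - pcf_convergent R a b n| < pcf_reduced_den R a b n `^ (- (1 + dl))
    & (N <= n)%N].
  by near=> n; split; near: n => //; exact: nbhs_infty_ge.
(* The error [|r n| / |Q n|] will be at least [(f / C) ^ n.+1]; [D] is the resulting base for the
   reduced denominator. *)
pose D := expR (- (ln (f / C) / (1 + dl))).
have D0 : 0 < D by exact: expR_gt0.
exists (f / D) => [|m]; first by rewrite divr_gt0.
have [n] := hf (maxn m M); rewrite geq_max => /andP[mn Mn] fn.
exists n => //; have [+ + Nn] := hM n Mn.
have Qn : 0 < `|Q n| by rewrite normr_gt0 Q0.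
have -> : `|L - pcf_convergent R a b n| = `|r n| / `|Q n|.
  rewrite (pcf_convergentE R d) -/P -/Q distrC.
  by rewrite -normfV -normrM mulrBl mulfK ?Q0.
rewrite ltr_pdivrMr// mul1r => rQ irr.
have fC : (f / C) ^+ n.+1 <= pcf_reduced_den R a b n `^ (- (1 + dl)).
  rewrite (le_trans _ (ltW irr))// expr_div_n.
  rewrite ler_pM ?invr_ge0 ?exprn_ge0 ?(ltW f0) ?(ltW C0)//.
  by rewrite lef_pV2 ?posrE ?exprn_gt0//; exact: QC.
have x0 : 0 < pcf_reduced_den R a b n.
  by rewrite (pcf_reduced_denE R d) divr_gt0// G0.
have := powRN_ge_exp e0 (divr_gt0 f0 C0) x0 fC; rewrite -/D.
rewrite (pcf_reduced_denE R d) ler_pdivrMr ?G0// => QD.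
rewrite expr_div_n ler_pdivrMr ?exprn_gt0// mulrC.
by rewrite (le_trans fn)// (le_trans (ltW rQ)).
Unshelve. all: by end_near.
Qed.

(** The scaled sequences grow at most exponentially, and dividing by an exponentially bounded below
    gcd preserves this. *)
Lemma exponential_order_of_large_gcd :
  large_gcd -> exponential_order_subseq R a b.
Proof.
move=> [c cgt0 hc].
have [C C1 PC] := lin_rec_upper alK beK scaled_num_rec.
have [D D1 QD] := lin_rec_upper alK beK scaled_den_rec.
have C0 : 0 <= C by rewrite (le_trans ler01).
have D0 : 0 <= D by rewrite (le_trans ler01).
(* [C * D] dominates both growth rates; the final base is [B ^ 2] because [n.+1 <= 2 * n] for
   [n > 0]. *)
pose B := Num.max 1 (C * D / c).
have B1 : 1 <= B by rewrite /B le_max lexx.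
have B0 : 0 <= B by rewrite (le_trans ler01).
have xB x n : (0 < n)%N -> x <= C ^+ n.+1 \/ x <= D ^+ n.+1 ->
    c ^+ n.+1 <= G n -> x / G n <= (B ^+ 2) ^+ n.
  move=> n0 hx cG.
  have Gn : 0 < G n by rewrite (lt_le_trans _ cG)// exprn_gt0.
  have {hx}xE : x <= (C * D) ^+ n.+1.
    rewrite exprMn; case: hx => /le_trans; apply.
      by rewrite ler_peMr ?exprn_ge0 ?exprn_ege1.
    by rewrite ler_peMl ?exprn_ge0 ?exprn_ege1.
  rewrite ler_pdivrMr// (le_trans xE)//.
  rewrite (@le_trans _ _ (B ^+ n.+1 * c ^+ n.+1))//.
    rewrite -exprMn lerXn2r ?nnegrE ?mulr_ge0 ?(ltW cgt0)//.
    by rewrite -ler_pdivrMr// /B le_max lexx orbT.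
  rewrite ler_pM ?exprn_ge0 ?(ltW cgt0)// -exprM ler_weXn2l//; lia.
have [phi phi_inc hphi] : exists2 phi : nat -> nat, increasing_seq phi &
    forall k, (0 < phi k)%N /\ c ^+ (phi k).+1 <= G (phi k).
  apply: (@increasing_subseq (fun n => (0 < n)%N /\ c ^+ n.+1 <= G n)) => m.
  by have [n mn cn] := hc m.+1; exists n; [exact: ltnW|split=> //; lia].
exists (B ^+ 2), phi; split=> // k; have [k0 ck] := hphi k.
rewrite (pcf_reduced_numE R d) (pcf_reduced_denE R d).
by split; apply: xB => //; [left; exact: PC|right; exact: QD].
Qed.

(** Along the subsequence, [f ^ n.+1 <= |P n| + |Q n| <= 2 * C ^ n * G n]. *)
Lemma large_gcd_of_exponential_order : casoratian P Q N != 0 ->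
  exponential_order_subseq R a b -> large_gcd.
Proof.
move=> W0 [C [phi [phi_inc hC]]].
have [f f0 hf] :=
  lin_rec_lower_max alK beK c0 bec scaled_num_rec scaled_den_rec W0.
(* [C] may be negative or less than 1. *)
pose B := Num.max 1 `|C|.
have B1 : 1 <= B by rewrite /B le_max lexx.
have B0 : 0 < B by rewrite (lt_le_trans ltr01).
have CB n : C ^+ n <= B ^+ n.+1.
  rewrite (le_trans (ler_norm _))// normrX (@le_trans _ _ (B ^+ n))//.
    by rewrite lerXn2r ?nnegrE ?(ltW B0)// /B le_max lexx orbT.
  by rewrite ler_weXn2l.
exists (f / (2 * B)) => [|m]; first by rewrite divr_gt0 ?mulr_gt0.
(* This places [phi (maxn m N)] beyond both [m] and [N]. *)
have phi_ge k : (k <= phi k)%N.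
  elim: k => // k IH; rewrite (leq_ltn_trans IH)//.
  by have /increasing_seqP/(_ k) := phi_inc; rewrite ltEnat.
have mphi := phi_ge (maxn m N).
have [] := hC (maxn m N); move: mphi; move: (phi _) => n.
rewrite geq_max => /andP[mn Nn].
rewrite (pcf_reduced_numE R d) (pcf_reduced_denE R d).
rewrite !ler_pdivrMr ?G0// => hP hQ; exists n => //.
rewrite expr_div_n ler_pdivrMr ?exprn_gt0 ?mulr_gt0//.
rewrite (le_trans (hf n Nn))// (le_trans (lerD hP hQ))//.
rewrite -mulrDl mulrC ler_wpM2l ?(ltW (G0 _))// exprMn.
rewrite (@le_trans _ _ (2 * B ^+ n.+1))//; first by have := CB n; lra.
by rewrite ler_wpM2r ?exprn_ge0 ?(ltW B0)// ler_eXnr// ler1n.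
Qed.

End Main.

Theorem theorem1 (R : realType) (d : nat) (a b : {poly int}) (L : R)
    (hd : (1 <= d)%N)
    (ha : size a = d.+1) (hb : size b = (2 * d).+1)
    (hB : - ((lead_coef a)%:~R ^+ 2 / 4%:R) < (lead_coef b)%:~R :> R)
    (hL : pcf_converges_to a b L) :
  (((-1)%:E < irrationality_measure a b L)%E -> factorial_reduction R a b) /\
  (factorial_reduction R a b <-> exponential_order_subseq R a b).
Proof.
have [K hK] := scaled_bounded R ha hb.
have alK n := (hK n).1; have beK n := (hK n).2.
have [N1 hN1] := scaled_b_lower R hb.
have [[N2 _ hN2] _] := hL.
pose N := maxn N1 N2.
have bec n : (N <= n)%N -> 2^-1 <= `|scaled_b R d b n|.
  by move=> Nn; apply: hN1; rewrite (leq_trans _ Nn)// leq_maxl.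
have q0 n : (N <= n)%N -> pcf_den a b n != 0.
  by move=> Nn; apply: hN2; rewrite /= (leq_trans _ Nn)// leq_maxr.
rewrite (factorial_reductionP R b ha) -/(large_gcd R d a b).
(* If the Casoratian vanishes, large gcd and exponential order both hold outright, which settles
   every implication. *)
have [W0|W0] :=
  eqVneq (casoratian (scaled R d (pcf_num a b)) (scaled R d (pcf_den a b)) N) 0.
  have lg := large_gcd_degenerate alK bec q0 W0.
  by have eo := exponential_order_degenerate q0 W0.
split; first exact: (large_gcd_of_irrationality hL alK beK bec q0 W0).
split; first exact: (exponential_order_of_large_gcd alK beK).
exact: (large_gcd_of_exponential_order alK beK bec q0 W0).
Qed.
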